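(* Let $G$ be a graph of order $n\geq 3$ with super domination number $\gamma_{sp}(G)$. Then $$C_s(G)\leq n+2-\gamma_{sp}(G).$$
   Context: All graphs are finite, simple and undirected. The order of $G$ is $|V(G)|$. $N(v)$ denotes the open neighborhood of a vertex $v$, and for $S\subseteq V(G)$ we write $\overline{S}=V(G)\setminus S$. A set $S\subseteq V(G)$ is a dominating set if every vertex of $\overline{S}$ is adjacent to a vertex of $S$. A dominating set $S$ is a super dominating set if for every $u\in\overline{S}$ there exists $v\in S$ with $N(v)\cap\overline{S}=\{u\}$. The super domination number $\gamma_{sp}(G)$ is the minimum cardinality of a super dominating set of $G$. A super coalition partition of $G$ is a partition $\{A_1,\dots,A_k\}$ of $V(G)$ (into nonempty parts) such that (i) no part $A_i$ is a super dominating set of $G$, and (ii) for every part $A_i$ there is at least one distinct part $A_j$ ($j\neq i$) such that $A_i\cup A_j$ is a super dominating set of $G$. The super coalition number $C_s(G)$ is the maximum cardinality of a super coalition partition of $G$, with $C_s(G)=0$ if $G$ admits no super coalition partition. *)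

(* Defs.v *)
From mathcomp Require Import all_boot.
Set Implicit Arguments.
Unset Strict Implicit.
Unset Printing Implicit Defensive.

Record sgraph := SGraph {
  vertex :> finType;
  adj : rel vertex;
  adj_sym : symmetric adj;
  adj_irrefl : irreflexive adj }.

Definition open_nbhd (G : sgraph) (v : G) : {set G} := [set u | adj v u].

Definition dominating (G : sgraph) (S : {set G}) : bool :=
  [forall u in ~: S, [exists v in S, adj u v]].

Definition super_dominating (G : sgraph) (S : {set G}) : bool :=
  dominating S &&
  [forall u in ~: S, [exists v in S, open_nbhd v :&: ~: S == [set u]]].

Lemma super_dominating_setT (G : sgraph) : super_dominating [set: G].
Proof. by apply/andP; split; apply/forall_inP => u; rewrite setCT inE. Qed.

(* A minimum over a nonempty family, since [set: G] is super dominating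
   (super_dominating_setT). *)
Definition super_domination_number (G : sgraph) : nat :=
  #|[arg min_(S < [set: G] | super_dominating S) #|S|]|.

(* MathComp's partition requires the parts to be nonempty. *)
Definition super_coalition_partition (G : sgraph) (P : {set {set G}}) : bool :=
  [&& partition P [set: G],
      [forall A in P, ~~ super_dominating A] &
      [forall A in P, [exists B in P,
        (B != A) && super_dominating (A :|: B)]]].

(* The maximum over an empty family of naturals is 0, as in the convention
   for graphs without a super coalition partition. *)
Definition super_coalition_number (G : sgraph) : nat :=
  \max_(P : {set {set G}} | super_coalition_partition P) #|P|.

(* So the truncated subtraction n + 2 - super_domination_number G is exact
   when n is the order of G. *)
Lemma super_domination_number_le (G : sgraph) :
  super_domination_number G <= #|G|.
Proof. exact: max_card. Qed.

(* Main.v *)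
(** A super coalition [A :|: B] has at least [super_domination_number G]
    vertices, and the other parts, being nonempty, number at most the vertices
    outside [A :|: B]. *)
Require Import Defs.
From mathcomp Require Import all_boot.
Set Implicit Arguments.
Unset Strict Implicit.
Unset Printing Implicit Defensive.

(** One coalition suffices: any part [A] has a partner [B] with [A :|: B] super dominating, and
    [card_partition_two_parts] trades the size of that union against [#|P|]. *)

Lemma super_domination_number_min (G : sgraph) (S : {set G}) :
  super_dominating S -> super_domination_number G <= #|S|.
Proof.
rewrite /super_domination_number => domS.
case: arg_minnP => [|T _]; first exact: super_dominating_setT.
exact.
Qed.

(** Every other part uses up at least one element of [D]; the 2 counts [A] and [B] themselves. *)
Lemma card_partition_two_parts (T : finType) (P : {set {set T}})
    (D A B : {set T}) :
  partition P D -> A \in P -> B \in P -> B != A ->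
  #|P| + #|A :|: B| <= #|D| + 2.
Proof.
move=> partP PA PB neqBA.
have PB' : B \in P :\ A by rewrite in_setD1 neqBA.
have card_rest : #|P :\ A :\ B| <= \sum_(C in P :\ A :\ B) #|C|.
  rewrite -sum1_card; apply: leq_sum => C /setD1P[_ /setD1P[_ PC]].
  by rewrite card_gt0 (partition_neq0 partP PC).
rewrite (card_partition partP) (big_setD1 A) //= (big_setD1 B) //=.
rewrite (cardsD1 A P) PA (cardsD1 B (P :\ A)) PB' !add1n addn2 !addSn !ltnS.
by rewrite addnC addnA leq_add // cardsU leq_subr.
Qed.

Theorem theorem3p2 (G : sgraph) (n : nat) (order_G : #|G| = n)
    (n_ge3 : 3 <= n) :
  super_coalition_number G <= n + 2 - super_domination_number G.
Proof.
apply/bigmax_leqP => P /and3P[partP _ /forall_inP coalP].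
(* An empty [P] offers no coalition, but the bound is then trivial. *)
have [-> | [A PA]] := set_0Vmem P; first by rewrite cards0.
have /exists_inP[B PB /andP[neqBA domAB]] := coalP A PA.
have le_card := card_partition_two_parts partP PA PB neqBA.
rewrite cardsT order_G in le_card.
(* The truncated subtraction is exact here, so it can move across. *)
rewrite leq_subRL; last first.
  apply: leq_trans (leq_addr _ _).
  by rewrite -order_G super_domination_number_le.
rewrite addnC; apply: leq_trans le_card.
by rewrite leq_add2l super_domination_number_min.
Qed.
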